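(* Let $X$ be a real uniformly convex and uniformly smooth Banach space and let $r>0$. Let $r\mathbb{B}$ be the closed ball in $X$ with radius $r$ centered at the origin, $r\mathbb{B}^o$ its interior, and $P_{r\mathbb{B}}:X\to r\mathbb{B}$ the metric projection. For $\bar{x}\in X$ with $\bar{y}=P_{r\mathbb{B}}(\bar{x})$, the covering constant of $P_{r\mathbb{B}}$ at $(\bar{x},\bar{y})$ satisfies: (a) $\hat{\alpha}(P_{r\mathbb{B}},\bar{x},\bar{y})=1$ for any $\bar{x}\in r\mathbb{B}^o$; (b) $\hat{\alpha}(P_{r\mathbb{B}},\bar{x},\bar{y})=0$ for any $\bar{x}\in X\setminus (r\mathbb{B}^o)$.
   Context: Let $(X,\|\cdot\|)$ be a real uniformly convex and uniformly smooth Banach space with dual $(X^*,\|\cdot\|_* )$ and duality pairing $\langle\cdot,\cdot\rangle$. For a nonempty closed convex $C\subset X$, the metric projection $P_C:X\to C$ is the (single-valued, continuous) map such that $\|x-P_C(x)\|\le\|x-z\|$ for all $z\in C$. $\mathbb{B}(c,\eta)$ denotes the closed ball in $X$ with center $c$ and radius $\eta$. The Mordukhovich derivative (coderivative) of $P_C$ at $(x,y)$ with $y=P_C(x)$ is the set-valued map $\widehat{D}^*P_C(x,y):X^*\rightrightarrows X^*$ given by $$\widehat{D}^*P_C(x,y)(w^* )=\left\{z^*\in X^*:\limsup_{u\to x}\frac{\langle z^*,u-x\rangle-\langle w^*,P_C(u)-P_C(x)\rangle}{\|u-x\|+\|P_C(u)-P_C(x)\|}\le 0\right\}.$$ For $\bar{y}=P_C(\bar{x})$,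 the covering constant of $P_C$ at $(\bar{x},\bar{y})$ is $$\hat{\alpha}(P_C,\bar{x},\bar{y})=\sup_{\eta>0}\inf\{\|z^*\|_*: z^*\in\widehat{D}^*P_C(x,y)(w^* ),\ x\in\mathbb{B}(\bar{x},\eta),\ y=P_C(x)\in\mathbb{B}(\bar{y},\eta),\ w^*\in X^*,\ \|w^*\|_*=1\}.$$ *)

(* Defs.v *)
From HB Require Import structures.
From mathcomp Require Import all_boot all_order all_algebra.
From mathcomp Require Import all_classical all_reals all_analysis.
Import Order.TTheory GRing.Theory Num.Theory.
Import numFieldNormedType.Exports.

Set Implicit Arguments.
Unset Strict Implicit.
Unset Printing Implicit Defensive.

Local Open Scope classical_set_scope.
Local Open Scope ring_scope.

Section Geometry.
Context {R : realType} (X : normedModType R).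

Definition uniformly_convex : Prop :=
  forall e : R, 0 < e -> exists2 d : R, 0 < d &
    forall x y : X, `|x| = 1 -> `|y| = 1 -> e <= `|x - y| ->
      `|2^-1 *: (x + y)| <= 1 - d.

Definition uniformly_smooth : Prop :=
  forall e : R, 0 < e -> exists2 d : R, 0 < d &
    forall x y : X, `|x| = 1 -> `|y| <= d ->
      `|x + y| + `|x - y| <= 2 + e * `|y|.

End Geometry.

Section Dual.
Context {R : realType} (X : normedModType R).

Record dual := Dual {
  dual_fun :> {linear X -> R^o};
  dual_continuous : continuous dual_fun }.

(* The set below is nonempty, and it is bounded above because a continuous
   linear form is bounded, so the real-valued [sup] is a true supremum. *)
Definition dual_norm (f : dual) : R := sup [set `|f x| | x in closed_ball 0 1].

End Dual.

Section Projection.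
Context {R : realType} {X : normedModType R}.

Definition nearest_points (C : set X) (x : X) : set X :=
  [set y | C y /\ forall z, C z -> `|x - y| <= `|x - z|].

(* The default value 0 only matters when [x] has no nearest point in [C], which
   cannot happen for C nonempty closed convex in a uniformly convex Banach
   space; the nearest point is then also unique. *)
Definition metric_projection (C : set X) (x : X) : X :=
  xget 0 (nearest_points C x).

End Projection.

Section Covering.
Context {R : realType} {X : normedModType R}.

(* The limsup is over the punctured neighborhoods [x^'], on which the
   denominator does not vanish. *)
Definition mordukhovich_derivative (P : X -> X) (x y : X) (w : dual X) :
    set (dual X) :=
  [set z : dual X | (limf_esup
     (fun u => ((z (u - x) - w (P u - y)) / (`|u - x| + `|P u - y|))%:E)
     x^' <= 0)%E].

(* Valued in \bar R, with inf and sup those of the extended real line. *)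
Definition covering_constant (P : X -> X) (xbar ybar : X) : \bar R :=
  ereal_sup [set ereal_inf [set (dual_norm z)%:E | z in
      [set z : dual X | exists x y w,
        [/\ closed_ball xbar eta x, y = P x, closed_ball ybar eta y,
            dual_norm w = 1 & mordukhovich_derivative P x y w z]]]
    | eta in [set eta : R | 0 < eta]].

End Covering.

(* Main.v *)
From HB Require Import structures.
Require Import Defs.
From mathcomp Require Import all_boot all_order all_algebra.
From mathcomp Require Import all_classical all_reals all_analysis.
From mathcomp Require Import ring lra.
Import Order.TTheory GRing.Theory Num.Theory.
Import numFieldNormedType.Exports.

Local Open Scope classical_set_scope.
Local Open Scope ring_scope.

(** Inside the ball the projection [P] is locally the identity, whose coderivative
    sends a form [w] to [w] alone ([mordukhovich_derivative_id]).  Given a form of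
    norm one, the infimum is then 1 for small radii, and at most 1 for the
    others ([covering_constant_id]).

    Let [xbar] be outside the open ball.  Then [y = P xbar] lies on the sphere,
    and there is a form [w] of norm one with [w y = - r], namely a support form
    at [- y / r].  It attains its minimum over the ball at [y], while [P] takes
    its values in the ball, so [w (P u - y) >= 0] for all [u].  This puts the
    null form in the coderivative at [xbar] itself
    ([mordukhovich_derivative_null]), for every radius [eta], and the covering
    constant vanishes.

    Uniform smoothness provides the support forms: the one-sided directional
    derivative of the norm is sublinear by convexity, and smoothness makes it
    odd, hence linear ([smooth_support_form]).  Uniform convexity makes the
    nearest point of the ball unique, so that the projection of a point outside
    the ball is the radial one ([metric_projection_ball]). *)

(** * Continuous linear forms *)

Section DualForms.
Context {R : realType} {X : normedModType R}.
Implicit Types (f g w z : dual X).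

Lemma dual_of_contraction (f : X -> R) :
  (forall a u v, f (a *: u + v) = a * f u + f v) ->
  (forall v, `|f v| <= `|v|) -> exists w : dual X, forall v, w v = f v.
Proof.
move=> f_lin f_le.
pose l : {linear X -> R^o} :=
  HB.pack (f : X -> R^o) (GRing.isLinear.Build R X R^o *:%R f f_lin).
have l_cont : continuous l.
  apply: bounded_linear_continuous; apply/linear_boundedP.
  near=> k => x; apply: le_trans (f_le x) _.
  by rewrite ler_peMl//; near: k; exact: nbhs_pinfty_ge.
by exists (Dual l_cont).
Unshelve. all: by end_near. Qed.

Lemma eq_dual_norm f g : f =1 g -> dual_norm f = dual_norm g.
Proof.
by move=> fg; rewrite /dual_norm; congr (sup (_ @` _)); apply/funext => v; rewrite fg.
Qed.

Lemma dual_norm_ge0 f : 0 <= dual_norm f.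
Proof.
rewrite /dual_norm; set A := (X in sup X).
have [supA|/sup_out->//] := pselect (has_sup A).
apply: (@le_trans _ _ `|f 0|) => //; apply: ub_le_sup; first by case: supA.
by exists 0 => //; apply: closed_ballxx; exact: ltr01.
Qed.

Lemma dual_norm0 f : (forall v, f v = 0) -> dual_norm f = 0.
Proof.
move=> f0; apply/eqP; rewrite eq_le dual_norm_ge0 andbT; apply: ge_sup.
  by exists `|f 0|, 0 => //; apply: closed_ballxx; exact: ltr01.
by move=> _ [v _ <-]; rewrite f0 normr0.
Qed.

Lemma dual_norm_support f x :
  (forall v, `|f v| <= `|v|) -> `|x| = 1 -> f x = 1 -> dual_norm f = 1.
Proof.
move=> f_le x1 fx.
have ub1 : ubound [set `|f v| | v in closed_ball 0 1] 1.
  move=> _ [v + <-]; rewrite closed_ballE// /closed_ball_/= sub0r normrN => v1.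
  exact: le_trans (f_le v) v1.
have mem1 : [set `|f v| | v in closed_ball 0 1] 1.
  exists x; last by rewrite fx normr1.
  by rewrite closed_ballE// /closed_ball_/= sub0r normrN x1.
apply/eqP; rewrite eq_le; apply/andP; split.
- by apply: ge_sup => //; exists 1.
- by apply: ub_le_sup => //; exists 1.
Qed.

End DualForms.

(** * Support forms of a uniformly smooth space *)

Section SupportForms.
Context {R : realType} {X : normedModType R}.

Definition norm_slope (x v : X) (t : R) : R := (`|x + t *: v| - `|x|) / t.

(** The right directional derivative of the norm: by convexity the slope is a
    nondecreasing function of the step, so that its limit at 0+ is its infimum. *)
Definition norm_rderiv (x v : X) : R :=
  inf [set norm_slope x v t | t in [set t : R | 0 < t]].

Lemma norm_slope_ge (x v : X) (t : R) : 0 < t -> - `|v| <= norm_slope x v t.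
Proof.
move=> t0; rewrite /norm_slope ler_pdivlMr// mulNr.
have := ler_normB (x + t *: v) (t *: v).
by rewrite addrK normrZ (gtr0_norm t0); lra.
Qed.

Lemma norm_rderiv_le (x v : X) (t : R) :
  0 < t -> norm_rderiv x v <= norm_slope x v t.
Proof.
move=> t0; apply: ge_inf; last by exists t.
by exists (- `|v|) => _ [s /= s0 <-]; exact: norm_slope_ge.
Qed.

Lemma norm_rderiv_glb (x v : X) (a : R) :
  (forall t, 0 < t -> a <= norm_slope x v t) -> a <= norm_rderiv x v.
Proof.
move=> a_le; apply: lb_le_inf.
  by exists (norm_slope x v 1), 1 => //=; exact: ltr01.
by move=> _ [t /= t0 <-]; exact: a_le.
Qed.

Lemma norm_rderiv_le_norm (x v : X) : norm_rderiv x v <= `|v|.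
Proof.
apply: le_trans (norm_rderiv_le x v _ ltr01) _.
by rewrite /norm_slope scale1r divr1; have := ler_normD x v; lra.
Qed.

Lemma norm_rderiv_self (x : X) : norm_rderiv x x = `|x|.
Proof.
apply/eqP; rewrite eq_le norm_rderiv_le_norm; apply: norm_rderiv_glb => t t0.
rewrite /norm_slope -[X in X + t *: _]scale1r -scalerDl normrZ gtr0_norm; last lra.
by rewrite le_eqVlt; apply/orP; left; apply/eqP; field; exact: lt0r_neq0.
Qed.

(** Convexity of the norm: for steps [t] and [s], the point reached from [x] in
    the direction [u + v] with the harmonic step [t * s / (t + s)] is a convex
    combination of [x + t *: u] and [x + s *: v]. *)
Lemma norm_rderivD (x u v : X) :
  norm_rderiv x (u + v) <= norm_rderiv x u + norm_rderiv x v.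
Proof.
rewrite -lerBlDr; apply: norm_rderiv_glb => t t0.
rewrite lerBlDr -lerBlDl; apply: norm_rderiv_glb => s s0.
rewrite lerBlDl.
have ts0 : 0 < t + s by lra.
have k0 : 0 < t * s / (t + s) by rewrite divr_gt0// mulr_gt0.
apply: le_trans (norm_rderiv_le x (u + v) _ k0) _.
rewrite /norm_slope.
have -> : x + (t * s / (t + s)) *: (u + v) =
    (s / (t + s)) *: (x + t *: u) + (t / (t + s)) *: (x + s *: v).
  rewrite !scalerDr !scalerA addrACA -scalerDl -mulrDl (addrC s) divff ?gt_eqF//.
  by rewrite scale1r; congr (_ + (_ *: _ + _ *: _)); field; rewrite gt_eqF.
have := ler_normD ((s / (t + s)) *: (x + t *: u)) ((t / (t + s)) *: (x + s *: v)).
rewrite (normrZ _ (x + t *: u)) (normrZ _ (x + s *: v)).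
rewrite (gtr0_norm (divr_gt0 s0 ts0)) (gtr0_norm (divr_gt0 t0 ts0)).
move: `|x + t *: u| `|x + s *: v| `|_ + _| => a b c abc.
rewrite ler_pdivrMr//.
suff -> : ((a - `|x|) / t + (b - `|x|) / s) * (t * s / (t + s)) =
    s / (t + s) * a + t / (t + s) * b - `|x| by lra.
by field; rewrite !gt_eqF.
Qed.

Lemma norm_rderivZ_ge (x v : X) (a : R) :
  0 < a -> a * norm_rderiv x v <= norm_rderiv x (a *: v).
Proof.
move=> a0; apply: norm_rderiv_glb => t t0.
rewrite mulrC -ler_pdivlMr//.
apply: le_trans (norm_rderiv_le x v _ (mulr_gt0 t0 a0)) _.
by rewrite /norm_slope scalerA invfM mulrA.
Qed.

Section Smooth.
Hypothesis X_smooth : uniformly_smooth X.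
Context (x : X) (x1 : `|x| = 1).

(** Smoothness says that the second difference of the norm is small with
    respect to the step, hence that the two one-sided derivatives agree. *)
Lemma norm_rderivN (v : X) : norm_rderiv x (- v) = - norm_rderiv x v.
Proof.
apply/eqP; rewrite eq_le; apply/andP; split; last first.
  rewrite -subr_ge0 opprK; apply: le_trans (norm_rderivD _ _ _).
  rewrite addNr; apply: norm_rderiv_glb => t _.
  by rewrite /norm_slope scaler0 addr0 subrr mul0r.
rewrite -subr_le0 opprK; apply/ler_addgt0Pl => e e0; rewrite addr0.
have v1_gt0 : 0 < `|v| + 1 by rewrite ltr_wpDl.
have [d d0 Hd] := X_smooth _ (divr_gt0 e0 v1_gt0).
pose t := d / (`|v| + 1).
have t0 : 0 < t by rewrite divr_gt0.
have tv : `|t *: v| = t * `|v| by rewrite normrZ gtr0_norm.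
have tvd : `|t *: v| <= d by rewrite tv /t mulrAC ler_pdivrMr//; nra.
have := Hd x (t *: v) x1 tvd; rewrite tv => second_diff.
have := norm_rderiv_le x (- v) _ t0; have := norm_rderiv_le x v _ t0.
rewrite /norm_slope scalerN x1 => dv dNv.
apply: le_trans (lerD dNv dv) _; rewrite -mulrDl ler_pdivrMr//.
apply: (@le_trans _ _ (e / (`|v| + 1) * (t * `|v|))); first lra.
rewrite mulrAC ler_pdivrMr//.
have := mulr_gt0 e0 t0; have := normr_ge0 v; nra.
Qed.

Lemma norm_rderiv_linear (a : R) (u v : X) :
  norm_rderiv x (a *: u + v) = a * norm_rderiv x u + norm_rderiv x v.
Proof.
have addD (p q : X) : norm_rderiv x (p + q) = norm_rderiv x p + norm_rderiv x q.
  apply/eqP; rewrite eq_le norm_rderivD/=.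
  have := norm_rderivD x (p + q) (- q); rewrite addrK norm_rderivN; lra.
have scale_gt0 (b : R) (p : X) :
    0 < b -> norm_rderiv x (b *: p) = b * norm_rderiv x p.
  move=> b0; apply/eqP; rewrite eq_le norm_rderivZ_ge// andbT.
  have := @norm_rderivZ_ge x (- p) b b0; rewrite scalerN !norm_rderivN; lra.
rewrite addD; congr (_ + _); have [a0|a0|->] := ltrgt0P a.
- exact: scale_gt0.
- rewrite -[a]opprK scaleNr norm_rderivN scale_gt0 ?oppr_gt0//; lra.
- rewrite scale0r mul0r; have := addD 0 0; rewrite addr0; lra.
Qed.

(** The gradient of the norm at [x] is a form supporting the unit ball at [x]:
    smoothness makes the directional derivative linear, and sublinearity bounds
    it by the norm. *)
Lemma smooth_support_form : exists w : dual X,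
  [/\ dual_norm w = 1, w x = 1 & forall v, `|w v| <= `|v| ].
Proof.
have contr v : `|norm_rderiv x v| <= `|v|.
  rewrite ler_norml norm_rderiv_le_norm andbT.
  by have := norm_rderiv_le_norm x (- v); rewrite norm_rderivN normrN; lra.
have [w wE] := dual_of_contraction _ norm_rderiv_linear contr.
have wx : w x = 1 by rewrite wE norm_rderiv_self.
have w_le v : `|w v| <= `|v| by rewrite wE.
by exists w; split => //; exact: (dual_norm_support w x).
Qed.

End Smooth.
End SupportForms.

(** * Metric projection onto a ball *)

Section BallProjection.
Context {R : realType} {X : normedModType R}.

Lemma metric_projection_id (C : set X) (x : X) :
  C x -> metric_projection C x = x.
Proof.
move=> Cx; apply: xget_unique => [|y [_ /(_ _ Cx)]].
  by split => // z _; rewrite subrr normr0.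
by rewrite subrr normr0 normr_le0 subr_eq0 => /eqP.
Qed.

Lemma uniformly_convex_eq (a b : X) : uniformly_convex X ->
  `|a| = 1 -> `|b| = 1 -> 2 <= `|a + b| -> a = b.
Proof.
move=> X_convex a1 b1 ab2; apply/eqP; rewrite -subr_eq0 -normr_eq0.
apply: contraT => ab; have ab0 : 0 < `|a - b| by rewrite lt_def ab normr_ge0.
have [d d0 /(_ a b a1 b1 (lexx _))] := X_convex _ ab0.
by rewrite normrZ gtr0_norm ?invr_gt0//; lra.
Qed.

(** A nearest point [y] to [x] satisfies [`|x - y| = `|x| - r], so that [y / r]
    and the normalization of [x] are unit vectors whose sum has norm 2. *)
Lemma metric_projection_ball (r : R) (x : X) : uniformly_convex X ->
  0 < r -> r <= `|x| ->
  metric_projection (closed_ball 0 r) x = (r / `|x|) *: x.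
Proof.
move=> X_convex r0 rx; have x0 : 0 < `|x| by lra.
have x_neq0 : `|x| != 0 by rewrite gt_eqF.
have ballE (y : X) : closed_ball 0 r y <-> `|y| <= r.
  by rewrite closed_ballE// /closed_ball_/= sub0r normrN.
have p_norm : `|(r / `|x|) *: x| = r.
  by rewrite normrZ gtr0_norm ?divr_gt0// divfK.
have p_dist : `|x - (r / `|x|) *: x| = `|x| - r.
  rewrite -[X in `|X - _|]scale1r -scalerBl normrZ ger0_norm.
    by rewrite mulrBl mul1r divfK.
  by rewrite subr_ge0 ler_pdivrMr// mul1r.
have p_ball : closed_ball 0 r ((r / `|x|) *: x) by apply/ballE; rewrite p_norm.
apply: xget_unique.
  split => // z /ballE zr; rewrite p_dist.
  by have := lerB_normD x (- z); rewrite normrN; lra.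
move=> y [/ballE yr /(_ _ p_ball)]; rewrite p_dist => xy.
have y_norm : `|y| = r.
  apply/eqP; rewrite eq_le yr /=.
  by have := ler_normD (x - y) y; rewrite subrK; lra.
have : `|x|^-1 *: x = r^-1 *: y.
  apply: uniformly_convex_eq => //.
  - by rewrite normrZ normfV normr_id mulVf.
  - by rewrite normrZ normfV gtr0_norm// y_norm mulVf ?gt_eqF.
  set s := _ + _.
  have xyE : x + y = r *: s + (1 - r / `|x|) *: x.
    rewrite scalerDr !scalerA divff ?gt_eqF// scale1r addrAC -scalerDl.
    by rewrite (addrC (r / _)) subrK scale1r.
  have := ler_normD (r *: s) ((1 - r / `|x|) *: x).
  rewrite -xyE !normrZ (gtr0_norm r0) ger0_norm; last first.
    by rewrite subr_ge0 ler_pdivrMr// mul1r.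
  have := ler_normD (x + y) (x - y).
  rewrite addrACA subrr addr0 -mulr2n normrMn mulr2n mulrBl mul1r divfK//.
  by move=> h1 h2; rewrite -(ler_pM2l r0); lra.
by move=> /(congr1 ( *:%R r)); rewrite !scalerA divff ?gt_eqF// scale1r => ->.
Qed.

Lemma metric_projection_ball_le (r : R) (x : X) : uniformly_convex X ->
  0 < r -> `|metric_projection (closed_ball 0 r) x| <= r.
Proof.
move=> X_convex r0; have [xr|/ltW rx] := leP `|x| r.
  rewrite metric_projection_id//.
  by rewrite closed_ballE// /closed_ball_/= sub0r normrN.
rewrite metric_projection_ball// normrZ gtr0_norm ?divr_gt0 ?(lt_le_trans r0)//.
by rewrite divfK// gt_eqF// (lt_le_trans r0).
Qed.

End BallProjection.

(** * The coderivative of a map *)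

Section Coderivative.
Context {R : realType} {X : normedModType R}.
Implicit Types (P : X -> X) (w z : dual X).

(** The denominator of the quotients dominates [`|u - x|], so that a bound of the
    numerator by [e * `|u - x|] bounds the quotient by [e]. *)
Lemma mordukhovich_derivative_near P (x y : X) w z :
  (forall e : R, 0 < e ->
     \forall u \near x, z (u - x) - w (P u - y) <= e * `|u - x|) ->
  mordukhovich_derivative P x y w z.
Proof.
move=> near_le; apply/lee_addgt0Pr => e e0; rewrite add0e.
apply: le_trans (ereal_inf_lbound _) (_ : _ <= e%:E)%E.
  exists [set u | z (u - x) - w (P u - y) <= e * `|u - x|] => //.
  exact/nbhs_dnbhs/near_le.
apply: ge_ereal_sup => _ [u /= u_le <-]; rewrite lee_fin.
set D := `|u - x| + _; have D_ge : `|u - x| <= D by rewrite lerDl.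
have [D0|D_neq0] := eqVneq D 0.
  (* At [u = x] the quotient is [0 / 0 = 0]. *)
  by rewrite D0 invr0 mulr0 ltW.
rewrite ler_pdivrMr; last by rewrite lt_def D_neq0 addr_ge0.
by apply: le_trans u_le _; rewrite ler_pM2l.
Qed.

(** If [w] attains its minimum over the ball of radius [r] at [y], then
    [w (P u - y)] is nonnegative for every map [P] into this ball, so that the
    quotients of the null form are never positive. *)
Lemma mordukhovich_derivative_null P (r : R) (x y : X) w z :
  (forall u, `|P u| <= r) -> (forall v, `|w v| <= `|v|) -> w y = - r ->
  (forall v, z v = 0) -> mordukhovich_derivative P x y w z.
Proof.
move=> P_le w_le wy z0; apply: mordukhovich_derivative_near => e e0.
apply: nearW => u; rewrite z0 linearB/= wy.
have := P_le u; have := mulr_ge0 (ltW e0) (normr_ge0 (u - x)).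
by have := w_le (P u); rewrite ler_norml => /andP[]; lra.
Qed.

(** Where [P] is the identity, the difference quotient in the direction [v] is
    the constant [(z v - w v) / (2 * `|v|)]; both [v] and [- v] bound it. *)
Lemma mordukhovich_derivative_id P (x : X) w z :
  (\forall u \near x, P u = u) ->
  mordukhovich_derivative P x (P x) w z -> z =1 w.
Proof.
move=> P_id z_in.
have le_zw (v : X) : z v <= w v.
  have [->|v0] := eqVneq v 0; first by rewrite !linear0.
  have nv0 : 0 < `|v| by rewrite normr_gt0.
  apply/ler_addgt0Pr => e e0.
  have k0 : 0 < e / (2 * `|v|) by rewrite divr_gt0// mulr_gt0.
  have : (0 < (e / (2 * `|v|))%:E)%E by rewrite lte_fin.
  move=> /(le_lt_trans z_in) /ereal_inf_lt[_ [V V_nbhs <-] supV].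
  have Px : P x = x by exact: nbhs_singleton P_id.
  have step : \forall t \near (0 : R), x + t *: v != x ->
      V (x + t *: v) /\ P (x + t *: v) = x + t *: v.
    have cvg_x : (x + t *: v) @[t --> (0 : R)] --> x.
      rewrite -[X in _ --> X]addr0 -(scale0r v).
      by apply: cvgD; [exact: cvg_cst | apply: cvgZr_tmp; exact: cvg_id].
    have : \forall u \near x, u != x -> V u /\ P u = u.
      move: V_nbhs; rewrite /dnbhs /within /= => V_nbhs.
      by near=> u => ux; split; [apply: (near V_nbhs u) | apply: (near P_id u)].
    exact: cvg_x.
  have [d /= d0 Hd] := step.
  pose t := d / 2; have t0 : 0 < t by rewrite divr_gt0.
  have td : `|0 - t| < d by rewrite sub0r normrN gtr0_norm// /t; lra.
  have xtvB : x + t *: v - x = t *: v by rewrite addrC addKr.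
  have xtv : x + t *: v != x.
    by rewrite -subr_eq0 xtvB scaler_eq0 negb_or gt_eqF.
  have [Vt Pt] := Hd t td xtv.
  have := le_lt_trans (ereal_sup_ubound (imageP _ Vt)) supV.
  have zt (f : dual X) : f (t *: v) = t * f v by rewrite linearZ.
  rewrite lte_fin Px Pt xtvB !zt normrZ gtr0_norm//.
  rewrite ltr_pdivrMr; last by rewrite addr_gt0// mulr_gt0.
  have -> : e / (2 * `|v|) * (t * `|v| + t * `|v|) = t * e.
    by field; rewrite gt_eqF.
  by rewrite -mulrBr ltr_pM2l//; lra.
move=> v; apply/eqP; rewrite eq_le le_zw /=.
by have := le_zw (- v); rewrite !linearN lerN2.
Unshelve. all: by end_near. Qed.

End Coderivative.

(** * The covering constant *)

Section CoveringConstant.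
Context {R : realType} {X : normedModType R}.
Implicit Types (P : X -> X) (w : dual X).

Lemma covering_constant_ge0 P (xbar ybar : X) :
  (0 <= covering_constant P xbar ybar)%E.
Proof.
apply: le_ereal_sup_tmp; eexists; first by exists 1 => //=; exact: ltr01.
by apply: le_ereal_inf_tmp => _ [z _ <-]; rewrite lee_fin dual_norm_ge0.
Qed.

Lemma covering_constant_le P (xbar ybar : X) (a : R) :
  (forall eta : R, 0 < eta -> exists x w z,
     [/\ closed_ball xbar eta x, closed_ball ybar eta (P x), dual_norm w = 1,
        mordukhovich_derivative P x (P x) w z & dual_norm z <= a]) ->
  (covering_constant P xbar ybar <= a%:E)%E.
Proof.
move=> near_xbar; apply: ge_ereal_sup => _ [eta /= /near_xbar + <-].
move=> [x [w [z [xeta Pxeta w1 z_in za]]]]; apply: ge_ereal_inf.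
exists (dual_norm z)%:E; last by rewrite lee_fin.
by exists z => //; exists x, (P x), w.
Qed.

Lemma covering_constant_id P (xbar : X) w :
  dual_norm w = 1 -> (\forall u \near xbar, P u = u) ->
  covering_constant P xbar (P xbar) = 1%E.
Proof.
move=> w1 P_id; apply/eqP; rewrite eq_le; apply/andP; split.
  apply: covering_constant_le => eta eta0; exists xbar, w, w.
  split; rewrite ?w1//; try exact: closed_ballxx.
  apply: mordukhovich_derivative_near => e e0; near=> u.
  have -> : P u = u by near: u.
  by rewrite (nbhs_singleton P_id) subrr mulr_ge0// ltW.
have [d /= d0 Hd] : exists2 d : R, 0 < d & ball xbar d `<=` [set u | P u = u].
  exact/nbhs_ballP.
apply: le_ereal_sup_tmp; eexists.
  by exists (d / 2) => //=; rewrite divr_gt0.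
apply: le_ereal_inf_tmp => _ [z [x [y [v [x_in -> _ v1 z_in]]]] <-].
suff zv : z =1 v by rewrite lee_fin (eq_dual_norm _ _ zv) v1.
apply: mordukhovich_derivative_id z_in.
have x_ball : ball xbar d x.
  by apply: closed_ball_subset x_in; lra.
near=> u; apply: Hd; near: u; apply: open_nbhs_nbhs; split => //.
exact: ball_open.
Unshelve. all: by end_near. Qed.

End CoveringConstant.

Theorem theorem3p1 (R : realType) (X : completeNormedModType R)
    (X_nontrivial : exists v : X, v != 0)
    (X_convex : uniformly_convex X) (X_smooth : uniformly_smooth X)
    (r : R) (r_gt0 : 0 < r) :
  let B : set X := closed_ball 0 r in
  let P : X -> X := metric_projection B in
  (forall xbar : X, interior B xbar ->
     covering_constant P xbar (P xbar) = 1%E) /\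
  (forall xbar : X, (~` interior B) xbar ->
     covering_constant P xbar (P xbar) = 0%E).
Proof.
have normalize (v : X) : v != 0 -> `| `|v|^-1 *: v| = 1.
  by move=> v0; rewrite normrZ normfV normr_id mulVf// normr_eq0.
move=> B P; split=> xbar xbarB.
  have [v v0] := X_nontrivial.
  have [w [w1 _ _]] := smooth_support_form X_smooth _ (normalize v v0).
  apply: (covering_constant_id _ _ _ w1).
  by near=> u; apply: metric_projection_id; near: u; exact: xbarB.
apply/eqP; rewrite eq_le covering_constant_ge0 andbT.
have xbar_ge : r <= `|xbar|.
  rewrite leNgt; apply/negP => xbar_lt; apply: xbarB.
  rewrite /interior; near=> u; rewrite /B closed_ballE// /closed_ball_/=.
  rewrite sub0r normrN; near: u.
  have : (fun u : X => `|u|) @ xbar --> `|xbar| by apply: cvg_norm; exact: cvg_id.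
  by move/cvgr_le; apply.
have nP : `|P xbar| = r.
  rewrite /P metric_projection_ball// normrZ gtr0_norm.
    by rewrite divfK// gt_eqF// (lt_le_trans r_gt0).
  by rewrite divr_gt0// (lt_le_trans r_gt0).
(* The form is the inner normal of the sphere at the projection: the outer
   normal would not do at points of the sphere itself, near which the
   projection is the identity on the inner side. *)
have e1 : `|- (r^-1 *: P xbar)| = 1.
  by rewrite normrN normrZ normfV gtr0_norm// nP mulVf ?gt_eqF.
have [w [w1 we w_le]] := smooth_support_form X_smooth _ e1.
have wP : w (P xbar) = - r.
  have -> : P xbar = - r *: - (r^-1 *: P xbar).
    by rewrite scaleNr scalerN opprK scalerA divff ?gt_eqF// scale1r.
  by rewrite linearZ/= we; exact: mulr1.
have [z zE] : exists z : dual X, forall v, z v = 0.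
  apply: dual_of_contraction => [a u v|v]; first by rewrite mulr0 addr0.
  by rewrite normr0.
apply: covering_constant_le => eta eta0; exists xbar, w, z.
split=> //; try exact: closed_ballxx; last by rewrite dual_norm0.
apply: mordukhovich_derivative_null w_le wP zE => u.
exact: metric_projection_ball_le.
Unshelve. all: by end_near. Qed.
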